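(* Let $m\geq 1$ be an integer and let $\beta>1$ be the root of $x^2-mx-m$. Then $\mathcal{L}(u_\beta)=\mathcal{L}(u_{-\beta})$. Moreover, if $m=1$, then $u_{-\beta}^+=0u_\beta$. When $m\geq 2$, neither $u_{-\beta}^+$ is a suffix of $u_\beta$, nor $u_\beta$ is a suffix of $u_{-\beta}^+$.
   Context: **Language and suffixes.** The language $\mathcal{L}(u)$ of a (one- or bidirectional) infinite word $u$ is the set of all its finite factors. A one-directional infinite word $v$ is a suffix of a one-directional infinite word $u$ if $u=wv$ for some finite (possibly empty) word $w$. **$\beta$-integers.** For $\beta>1$ let $T_\beta(x)=\beta x-\lfloor\beta x\rfloor$ on $[0,1)$, and for $x\in[0,1)$ put $d_\beta(x)=y_1y_2y_3\cdots$ with $y_i=\lfloor\beta T_\beta^{i-1}(x)\rfloor$. For real $x\geq 0$ choose an integer $k\ge 0$ with $x/\beta^k\in[0,1)$; if $d_\beta(x/\beta^k)=y_1y_2\cdots$, then $x$ is said to have an integer $\beta$-expansion if $y_i=0$ for all $i>k$ (this does not depend on the choice of $k$). $\mathbb{Z}_\beta^+$ is the set of all $x\geq 0$ with integer $\beta$-expansion, and $\mathbb{Z}_\beta=\mathbb{Z}_\beta^+\cup(-\mathbb{Z}_\beta^+)$. **$(-\beta)$-integers.** Let $l=-\frac{\beta}{\beta+1}$, $I=[l,l+1)$, $T(x)=-\beta x-\lfloor-\beta x-l\rfloor$ on $I$, and for $x\in I$ put $d_{-\beta}(x)=y_1y_2y_3\cdots$ with $y_i=\lfloor-\beta T^{i-1}(x)-l\rfloor$.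 For $x\in\mathbb{R}$ choose an integer $k\geq 0$ with $x/(-\beta)^k\in(l,l+1)$; if $d_{-\beta}(x/(-\beta)^k)=y_1y_2\cdots$, then $x\in\mathbb{Z}_{-\beta}$ if and only if $y_i=0$ for all $i>k$ (this does not depend on the choice of $k$). **Coding words.** For $\beta^2=m\beta+m$, the distances between consecutive elements of $\mathbb{Z}_\beta$ take the values $\Delta_0^+=1$, $\Delta_1^+=\frac{m}{\beta}$, and the distances between consecutive elements of $\mathbb{Z}_{-\beta}$ take the values $\Delta_0^-=1$, $\Delta_1^-=\frac{m}{\beta}$. Writing $\mathbb{Z}_\beta=\{t_j\mid j\in\mathbb{Z}\}$ with $t_0=0$, $t_j<t_{j+1}$, the word $u_\beta=u_0u_1u_2\cdots\in\{0,1\}^{\mathbb{N}}$ is defined by $u_j=X$ if $t_{j+1}-t_j=\Delta_X^+$. Writing $\mathbb{Z}_{-\beta}=\{t_j\mid j\in\mathbb{Z}\}$ with $t_0=0$, $t_j<t_{j+1}$, the pointed bidirectional word $u_{-\beta}=\cdots u_{-2}u_{-1}|u_0u_1u_2\cdots\in\{0,1\}^{\mathbb{Z}}$ is defined by $u_j=X$ if $t_{j+1}-t_j=\Delta_X^-$, and $u_{-\beta}^+=u_0u_1u_2\cdots$ is its part to the right of the delimiter. *)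

(* Defs.v *)
From HB Require Import structures.
From mathcomp Require Import all_boot all_order all_algebra.
From mathcomp Require Import all_classical all_reals.

Set Implicit Arguments.
Unset Strict Implicit.
Unset Printing Implicit Defensive.

Import Order.TTheory GRing.Theory Num.Theory.

Local Open Scope classical_set_scope.
Local Open Scope ring_scope.

Section Words.
Variable A : Type.
Implicit Types (u v : nat -> A) (w : seq A).

(* w followed by u: nth returns its default u (n - size w) when size w <= n *)
Definition wcat w u : nat -> A := fun n => nth (u (n - size w)%N) w n.

Definition suffix_of v u : Prop := exists w, u = wcat w v.

Definition language u : set (seq A) :=
  [set w | exists i n : nat, w = mkseq (fun k => u (i + k)%N) n].

Definition bi_language (u : int -> A) : set (seq A) :=
  [set w | exists (i : int) (n : nat), w = mkseq (fun k => u (i + k%:Z)) n].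

Definition right_part (u : int -> A) : nat -> A := fun n => u n%:Z.

End Words.

Section BetaIntegers.
Variable R : realType.
Implicit Types (beta x : R) (S : set R).

Definition Tpos beta x : R := beta * x - (Num.floor (beta * x))%:~R.

(* Digits are numbered from 1; the value at index 0 is never used. *)
Definition pos_digit beta x (i : nat) : int :=
  Num.floor (beta * iter i.-1 (Tpos beta) x).

Definition Zbeta_plus beta : set R :=
  [set x | 0 <= x /\ exists k : nat,
     0 <= x / beta ^+ k < 1 /\
     forall i : nat, (k < i)%N -> pos_digit beta (x / beta ^+ k) i = 0].

Definition Zbeta beta : set R :=
  Zbeta_plus beta `|` [set - x | x in Zbeta_plus beta].

Definition lneg beta : R := - (beta / (beta + 1)).

Definition Tneg beta x : R :=
  - beta * x - (Num.floor (- beta * x - lneg beta))%:~R.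

Definition neg_digit beta x (i : nat) : int :=
  Num.floor (- beta * iter i.-1 (Tneg beta) x - lneg beta).

Definition Zmbeta beta : set R :=
  [set x | exists k : nat,
     lneg beta < x / (- beta) ^+ k < lneg beta + 1 /\
     forall i : nat, (k < i)%N -> neg_digit beta (x / (- beta) ^+ k) i = 0].

(* There is at most one such t, so the choice below is a definite description;
   the zero function is the default if S has no such enumeration. *)
Definition enumerates S (t : int -> R) : Prop :=
  [/\ t 0 = 0, forall j, t j < t (j + 1) & range t = S].

Definition enumeration S : int -> R := xget (fun=> 0) (enumerates S).

(* For beta^2 = m beta + m the distances Delta_0 and Delta_1, which are the
   same for Zbeta and Zmbeta. *)
Definition Delta (m : nat) beta (X : 'I_2) : R :=
  if X == 0 then 1 else m%:R / beta.

(* The letter X such that t (j+1) - t j = Delta X, for t enumerating S;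
   the default 0 is returned for a distance that is not a Delta X. *)
Definition coding (m : nat) beta S (j : int) : 'I_2 :=
  let t := enumeration S in
  odflt 0 [pick X : 'I_2 | t (j + 1) - t j == Delta m beta X].

Definition u_beta (m : nat) beta : nat -> 'I_2 :=
  right_part (coding m beta (Zbeta beta)).

Definition u_mbeta (m : nat) beta : int -> 'I_2 :=
  coding m beta (Zmbeta beta).

End BetaIntegers.

(* Main.v *)
Require Import Defs.
From HB Require Import structures.
From mathcomp Require Import all_boot all_order all_algebra.
From mathcomp Require Import all_classical all_reals.
From mathcomp Require Import zify ring lra.

(* Let phi(0) = 0^m 1, phi(1) = 0^m, and let phi~(x) be the reversal of phi(x).
   Multiplying by beta stretches each gap of Zbeta into the block phi of its
   letter, so u_beta is the fixed point U of phi.  Multiplying by -beta also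
   reverses the line, so with u_{-beta} = rev(L)|W (L reads the left half
   leftwards) one gets W = phi(L) and L = phi~(W).
   Conversely, if t enumerates the points whose gaps code these words, then
   induction on k shows that k steps of the beta-transformation send
   x / (+-beta)^k to x - t_j for the point t_j whose tile contains x; hence the
   digits vanish after position k iff x is one of the points t_j.
   The identity phi(w) 0^m = 0^m phi~(w) makes both languages stable under phi
   composed with reversal, which gives their equality, and also 0^m L = phi(W).
   A suffix relation between U and W can be desubstituted, since every letter 1
   ends a block phi(0), into a suffix relation at a smaller shift, and so on
   for ever. *)

Set Implicit Arguments.
Unset Strict Implicit.
Unset Printing Implicit Defensive.

Import Order.TTheory GRing.Theory Num.Theory.

Local Open Scope classical_set_scope.
Local Open Scope ring_scope.

(** * Infinite words and substitutions *)

Section InfiniteWords.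
Variable A : eqType.
Implicit Types (x : A) (v w s : seq A) (u X Y : nat -> A) (f g : A -> seq A).

Definition is_prefix w u := w = mkseq u (size w).

Definition subst f w := flatten (map f w).

(** Encodes $Y=f(X)$ by finite prefixes; when $f$ is non-erasing their images are arbitrarily long,
    so they determine $Y$. *)
Definition is_image f X Y := forall w, is_prefix w X -> is_prefix (subst f w) Y.

Definition nonerasing f := forall x, (0 < size (f x))%N.

Lemma pre_mkseq u n : is_prefix (mkseq u n) u.
Proof. by rewrite /is_prefix size_mkseq. Qed.

Lemma pre_nth x0 w u i : is_prefix w u -> (i < size w)%N -> nth x0 w i = u i.
Proof. by rewrite /is_prefix => eq_w lt_i; rewrite eq_w nth_mkseq. Qed.

Lemma preP x0 w u :
  (forall i, (i < size w)%N -> nth x0 w i = u i) -> is_prefix w u.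
Proof.
move=> h; apply: (@eq_from_nth _ x0); first by rewrite size_mkseq.
by move=> i lt_i; rewrite nth_mkseq // h.
Qed.

Lemma pre_catl v s u : is_prefix (v ++ s) u -> is_prefix v u.
Proof.
case: v => [//|x v] h; apply: (preP (x0 := x)) => i lt_i.
by rewrite -(pre_nth x h) ?nth_cat ?lt_i // size_cat ltn_addr.
Qed.

Lemma pre_prefix v w u : prefix v w -> is_prefix w u -> is_prefix v u.
Proof. by case/prefixP => s -> /pre_catl. Qed.

Lemma prefix_pre v w u :
  is_prefix v u -> is_prefix w u -> (size v <= size w)%N -> prefix v w.
Proof.
move=> -> ->; rewrite !size_mkseq => le; rewrite prefixE size_mkseq.
by rewrite /mkseq -map_take take_iota (minn_idPl le).
Qed.

Lemma subst_cat f v w : subst f (v ++ w) = subst f v ++ subst f w.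
Proof. by rewrite /subst map_cat flatten_cat. Qed.

Lemma subst_cons f x w : subst f (x :: w) = f x ++ subst f w.
Proof. by []. Qed.

Lemma subst_rcons f w x : subst f (rcons w x) = subst f w ++ f x.
Proof. by rewrite -cats1 subst_cat /subst /= cats0. Qed.

Lemma subst_subst f g w : subst g (subst f w) = subst (subst g \o f) w.
Proof. by elim: w => //= x w IH; rewrite subst_cons subst_cat IH. Qed.

Lemma rev_subst f w : rev (subst f w) = subst (rev \o f) (rev w).
Proof.
by elim: w => //= x w IH; rewrite subst_cons rev_cat IH rev_cons subst_rcons.
Qed.

Lemma prefix_subst f v w : prefix v w -> prefix (subst f v) (subst f w).
Proof. by case/prefixP => s ->; rewrite subst_cat prefix_prefix. Qed.

Lemma infix_subst f v w : infix v w -> infix (subst f v) (subst f w).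
Proof.
case/infixP => p [s ->]; rewrite !subst_cat.
by apply/infixP; exists (subst f p), (subst f s).
Qed.

Lemma size_subst f w : nonerasing f -> (size w <= size (subst f w))%N.
Proof.
move=> f0; elim: w => // x w IH; rewrite subst_cons size_cat /=.
by have := f0 x; lia.
Qed.

Lemma ltn_size_subst f x w :
  nonerasing f -> (1 < size (f x))%N ->
  (size (x :: w) < size (subst f (x :: w)))%N.
Proof.
by move=> f0 fx; rewrite subst_cons size_cat /=; have := size_subst w f0; lia.
Qed.

(* Meant for chains of prefixes whose n-th term has more than n letters, so that
   the default x0 is never returned. *)
Definition limit x0 (p : nat -> seq A) (n : nat) := nth x0 (p n) n.

Lemma pre_limit x0 (p : nat -> seq A) n :
  (forall i, prefix (p i) (p i.+1)) -> (forall i, (i < size (p i))%N) ->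
  is_prefix (p n) (limit x0 p).
Proof.
move=> chain big.
have mono i j : (i <= j)%N -> prefix (p i) (p j).
  move/subnK<-; elim: (j - i)%N => [|k IH]; first exact: prefix_refl.
  exact: prefix_trans IH (chain _).
apply: (preP (x0 := x0)) => i lt_i; rewrite /limit.
have [/mono/prefixP[s ->]|/ltnW/mono/prefixP[s ps]] := leqP n i.
  by rewrite nth_cat lt_i.
by rewrite ps nth_cat big.
Qed.

Definition im x0 f X := limit x0 (fun n => subst f (mkseq X n.+1)).

Lemma image_im x0 f X : nonerasing f -> is_image f X (im x0 f X).
Proof.
move=> f0.
have pim n : is_prefix (subst f (mkseq X n.+1)) (im x0 f X).
  apply: (@pre_limit x0 (fun n => subst f (mkseq X n.+1))) => i.
    by rewrite (mkseqS _ i.+1) subst_rcons prefix_prefix.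
  by apply: leq_trans (size_subst _ f0); rewrite size_mkseq.
move=> w ->; apply: pre_prefix (pim (size w)).
by rewrite mkseqS subst_rcons prefix_prefix.
Qed.

Definition approx f x0 n := iter n (subst f) [:: x0].
Definition fixpoint f x0 := limit x0 (approx f x0).

Section FixPoint.
Variables (f : A -> seq A) (x0 : A).
Hypotheses (f0 : nonerasing f) (fx0 : (1 < size (f x0))%N).
Hypothesis fx0_head : prefix [:: x0] (f x0).

Lemma prefix_approx n : prefix (approx f x0 n) (approx f x0 n.+1).
Proof.
elim: n => [|n IH]; first by rewrite /approx /= /subst /= cats0.
by rewrite /approx !iterS prefix_subst.
Qed.

Lemma size_approx n : (n < size (approx f x0 n))%N.
Proof.
elim: n => // n IH; rewrite /approx iterS -/(approx f x0 n).
(* Every iterate begins with [x0], whose image has at least two letters; this makes the length grow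
   strictly. *)
have : prefix [:: x0] (approx f x0 n).
  elim: {IH} n => [|n IH]; first exact: prefix_refl.
  exact: prefix_trans IH (prefix_approx _).
case/prefixP => s eq; rewrite eq /= in IH *; have := ltn_size_subst s f0 fx0.
by rewrite /=; lia.
Qed.

Lemma pre_approx n : is_prefix (approx f x0 n) (fixpoint f x0).
Proof. exact: pre_limit prefix_approx size_approx. Qed.

Lemma prefix_fixpoint w :
  is_prefix w (fixpoint f x0) -> prefix w (approx f x0 (size w)).
Proof.
by move=> wX; apply: prefix_pre (pre_approx _) _ => //; apply/ltnW/size_approx.
Qed.

Lemma image_fixpoint : is_image f (fixpoint f x0) (fixpoint f x0).
Proof.
move=> w /prefix_fixpoint wX; apply: pre_prefix (pre_approx (size w).+1).
by rewrite /approx iterS prefix_subst.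
Qed.

End FixPoint.

(** * Factors of one-sided and two-sided words *)

Lemma languageP u w :
  language u w <-> exists p, is_prefix p u /\ infix w p.
Proof.
split=> [[i [n ->]]|[p [-> /infixP[a [b eq_p]]]]].
  exists (mkseq u (i + n)); split; first exact: pre_mkseq.
  apply/infixP; exists (mkseq u i), [::]; rewrite cats0 /mkseq iotaD map_cat.
  by rewrite add0n -{2}[i]addn0 iotaDl -map_comp.
exists (size a), (size w).
have := f_equal (fun s => take (size w) (drop (size a) s)) eq_p.
rewrite drop_size_cat // take_size_cat // => {1}<-.
have := f_equal size eq_p; rewrite size_mkseq !size_cat => ->.
rewrite /mkseq -map_drop -map_take drop_iota take_iota.
rewrite -(addn0 (0 + _)%N) iotaDl -map_comp add0n.
have -> : minn (size w) (size a + (size w + size b) - size a) = size w by lia.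
by [].
Qed.

Lemma language_infix u v w : infix v w -> language u w -> language u v.
Proof.
move=> vw /languageP[p [pu wp]]; apply/languageP; exists p; split=> //.
exact: infix_trans vw wp.
Qed.

Lemma pre_language u w : is_prefix w u -> language u w.
Proof. by move=> wu; apply/languageP; exists w; split=> //; apply: infix_refl. Qed.

Lemma language_subst f u w :
  is_image f u u -> language u w -> language u (subst f w).
Proof.
move=> fu /languageP[p [pu wp]]; apply/languageP.
by exists (subst f p); split; [exact: fu | exact: infix_subst].
Qed.

Lemma language_extend u w : language u w -> exists x, language u (rcons w x).
Proof.
move=> [i [n ->]]; exists (u (i + n)%N), i, n.+1.
by rewrite mkseqS.
Qed.

(* Y codes the left half, read from the delimiter leftwards. *)
Definition bi (X Y : nat -> A) (j : int) : A :=
  match j with Posz n => X n | Negz n => Y n end.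

Lemma bi_languageP X Y w :
  bi_language (bi X Y) w <->
  exists l r, [/\ is_prefix l Y, is_prefix r X & infix w (rev l ++ r)].
Proof.
have biE N M : rev (mkseq Y N) ++ mkseq X M
    = mkseq (fun k => bi X Y (k%:Z - N%:Z)) (N + M).
  rewrite /mkseq iotaD map_cat add0n; congr (_ ++ _); last first.
    rewrite -{2}[N]addn0 iotaDl -map_comp; apply: eq_map => k /=.
    by rewrite PoszD addrC addKr.
  rewrite -map_rev; apply: (@eq_from_nth _ (X 0)); rewrite !size_map ?size_rev // => i.
  rewrite size_iota => lt_i.
  rewrite !(nth_map 0%N) ?size_rev ?size_iota // nth_rev ?size_iota //.
  rewrite !nth_iota ?size_iota //; try lia.
  by have -> : (0 + i)%:Z - N%:Z = Negz (0 + (N - i.+1)) by lia.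
split=> [[i [n ->]]|[l [r [-> -> /infixP[a [b eq]]]]]].
  (* The window from $-N$ to $N-1$ contains the positions $i,\dots,i+n-1$; the factor starts at
     offset $a=i+N$ in it. *)
  set N := (`|i| + n)%N.
  exists (mkseq Y N), (mkseq X N); split; try exact: pre_mkseq.
  rewrite biE; set a := `|(i + N%:Z)%R|%N.
  have -> : (N + N = a + (n + (N + N - a - n)))%N by rewrite /a /N; lia.
  apply/infixP.
  exists (mkseq (fun k => bi X Y (k%:Z - N%:Z)) a).
  exists (mkseq (fun k => bi X Y ((a + n + k)%N%:Z - N%:Z)) (N + N - a - n)).
  rewrite /mkseq !iotaD !map_cat !add0n; congr (_ ++ _); congr (_ ++ _).
    rewrite -{1}[a]addn0 iotaDl -map_comp; apply: eq_map => k /=.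
    by congr bi; rewrite /a /N; lia.
  by rewrite -{1}[(a + n)%N]addn0 iotaDl -map_comp.
rewrite biE in eq.
exists ((size a)%:Z - (size l)%:Z), (size w).
have := f_equal (fun s => take (size w) (drop (size a) s)) eq.
rewrite drop_size_cat // take_size_cat // => {1}<-.
have := f_equal size eq; rewrite size_mkseq !size_cat => ->.
rewrite /mkseq -map_drop -map_take drop_iota take_iota.
rewrite -(addn0 (0 + _)%N) iotaDl -map_comp add0n.
have -> : minn (size w) (size a + (size w + size b) - size a) = size w by lia.
by apply: eq_map => k /=; congr bi; lia.
Qed.

Lemma bi_language_infix X Y v w :
  infix v w -> bi_language (bi X Y) w -> bi_language (bi X Y) v.
Proof.
move=> vw /bi_languageP[l [r [lY rX wp]]]; apply/bi_languageP; exists l, r.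
by split=> //; apply: infix_trans vw wp.
Qed.

Lemma bi_language_extend (u : int -> A) w :
  bi_language u w -> exists x, bi_language u (x :: w).
Proof.
move=> [i [n ->]]; exists (u (i - 1)), (i - 1), n.+1.
rewrite /mkseq /= addr0; congr cons.
rewrite -[in RHS](addn0 1%N) iotaDl -map_comp.
by apply: eq_map => k /=; rewrite PoszD addrA subrK.
Qed.

Definition shift n u : nat -> A := fun k => u (n + k)%N.

Lemma suffix_of_shift X Y : suffix_of Y X -> exists n, shift n X = Y.
Proof.
move=> [w ->]; exists (size w); apply/funext => k.
by rewrite /shift /wcat nth_default ?leq_addr // addKn.
Qed.

End InfiniteWords.

(** * The fixed points of the substitutions *)

Section Substitution.
(* The parameter is m - 1, so that blocks are visibly nonempty. *)
Variable m' : nat.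
Let m := m'.+1.
Implicit Types (x : 'I_2) (w : seq 'I_2) (X Y : nat -> 'I_2).

Definition phi x : seq 'I_2 := nseq m 0 ++ nseq (x == 0%R) 1.
Definition phir x : seq 'I_2 := nseq (x == 0%R) 1 ++ nseq m 0.
(** Since $W=\phi(L)$ and $L=\tilde\phi(W)$, the word $W$ must be fixed by $\phi\circ\tilde\phi$. *)
Definition sigma x : seq 'I_2 := subst phi (phir x).

Lemma neq0_ord2 x : x != 0 -> x = 1.
Proof. by case: x => [[|[|k]] lt_k] // _; apply: val_inj. Qed.

Lemma phir0 : phir 0 = 1 :: nseq m 0.
Proof. by rewrite /phir eqxx. Qed.

Lemma size_phi x : size (phi x) = (m + (x == 0%R))%N.
Proof. by rewrite size_cat !size_nseq. Qed.

Lemma size_phir x : size (phir x) = (m + (x == 0%R))%N.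
Proof. by rewrite size_cat !size_nseq addnC. Qed.

Lemma phi_gt0 : nonerasing phi.
Proof. by move=> x; rewrite size_phi. Qed.

Lemma size_phi0 : (1 < size (phi 0%R))%N.
Proof. by rewrite size_phi eqxx /m addn1. Qed.

Lemma phi0_head : prefix [:: 0] (phi 0).
Proof. by rewrite /phi /m /= prefix0s. Qed.

Lemma phir_gt0 : nonerasing phir.
Proof. by move=> x; rewrite size_phir. Qed.

Lemma sigma_gt0 : nonerasing sigma.
Proof. by move=> x; apply: leq_trans (phir_gt0 x) (size_subst _ phi_gt0). Qed.

Lemma rev_phi x : rev (phi x) = phir x.
Proof. by rewrite rev_cat !rev_nseq. Qed.

Lemma rev_subst_phi w : rev (subst phi w) = subst phir (rev w).
Proof.
rewrite rev_subst; congr flatten; apply: eq_map => x /=; exact: rev_phi.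
Qed.

Lemma rev_subst_phir w : rev (subst phir w) = subst phi (rev w).
Proof. by rewrite -[w in LHS]revK -rev_subst_phi revK. Qed.

(** On one letter $x$ both sides are $0^m$, then 1 if $x=0$, then $0^m$; so $0^m$ moves past the
    blocks one at a time. *)
Lemma subst_phi_conj w :
  subst phi w ++ nseq m 0 = nseq m 0 ++ subst phir w.
Proof.
elim: w => [|x w IH]; first by rewrite /subst /= cats0.
by rewrite !subst_cons -catA IH /phi /phir !catA.
Qed.

Lemma subst_sigma w : subst sigma w = subst phi (subst phir w).
Proof. by rewrite subst_subst. Qed.

(** * The words [U], [W] and [L] *)

Definition U := fixpoint phi 0.
Definition W := fixpoint sigma 0.
Definition L := im 0 phir W.

Lemma image_U : is_image phi U U.
Proof. exact: image_fixpoint phi_gt0 size_phi0 phi0_head. Qed.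

Lemma size_sigma0 : (1 < size (sigma 0%R))%N.
Proof.
rewrite /sigma phir0 subst_cons size_cat size_phi /m /=; lia.
Qed.

Lemma sigma0_head : prefix [:: 0] (sigma 0).
Proof. by rewrite /sigma phir0 subst_cons /phi /m /= prefix0s. Qed.

Lemma pre_approx_sigma n : is_prefix (approx sigma 0 n) W.
Proof. exact: pre_approx sigma_gt0 size_sigma0 sigma0_head _. Qed.

Lemma pre_approx_phi n : is_prefix (approx phi 0 n) U.
Proof. exact: pre_approx phi_gt0 size_phi0 phi0_head _. Qed.

Lemma image_W_L : is_image phir W L.
Proof. exact/image_im/phir_gt0. Qed.

Lemma image_L_W : is_image phi L W.
Proof.
move=> w wL; have wW := pre_mkseq W (size w).
(* With $p$ the prefix of [W] as long as $w$, the word $w$ is a prefix of $\tilde\phi(p)$, so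
   $\phi(w)$ is one of $\sigma(p)$, itself a prefix of [W]. *)
have wsub : prefix w (subst phir (mkseq W (size w))).
  apply: prefix_pre wL (image_W_L wW) _.
  by apply: leq_trans (size_subst _ phir_gt0); rewrite size_mkseq.
apply: pre_prefix (prefix_subst phi wsub) _.
rewrite -subst_sigma; exact: image_fixpoint sigma_gt0 size_sigma0 sigma0_head _ wW.
Qed.

Lemma U0 : U 0 = 0.
Proof. by rewrite -(pre_nth 0 (pre_approx_phi 0)). Qed.

Lemma W0 : W 0 = 0.
Proof. by rewrite -(pre_nth 0 (pre_approx_sigma 0)). Qed.

Lemma pre_L0 : is_prefix (1 :: nseq m 0) L.
Proof.
have := image_W_L (pre_approx_sigma 0).
by rewrite /approx /= subst_cons phir0 /subst /= cats0.
Qed.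

Lemma L0 : L 0 = 1.
Proof. by rewrite -(pre_nth 0 pre_L0). Qed.

(** By [subst_phi_conj], $\phi(w)0^m=0^m\tilde\phi(w)$ is a prefix of $0^mL$; the trailing $0^m$ is
    then dropped. *)
Lemma image_W_0L : is_image phi W (wcat (nseq m 0) L).
Proof.
move=> w /image_W_L wL.
have : is_prefix (subst phi w ++ nseq m 0) (wcat (nseq m 0) L).
  rewrite subst_phi_conj; apply: (preP (x0 := 0)) => i.
  rewrite size_cat size_nseq /wcat nth_cat size_nseq => lt_i.
  case: ltnP => le_i; first by rewrite !nth_nseq le_i.
  by rewrite [RHS]nth_default ?size_nseq // (pre_nth 0 wL) ?ltn_subLR.
by move/pre_catl.
Qed.

(** * Block positions and desubstitution *)

Lemma image_block X Y w a :
  is_image phi X Y -> is_prefix w X -> (a <= m)%N -> is_prefix (subst phi w ++ nseq a 0) Y.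
Proof.
(* The block of the next letter starts with $0^m$, whatever that letter is, and supplies the $a$
   zeros. *)
move=> XY wX le_a.
have /XY : is_prefix (rcons w (X (size w))) X.
  by rewrite [in rcons w]wX -mkseqS; exact: pre_mkseq.
rewrite subst_rcons {2}/phi -(subnKC le_a) nseqD -catA.
by rewrite (catA (subst phi w)) => /pre_catl.
Qed.

(* The position in phi(X) where the block of the letter X n starts. *)
Definition bpos X n := size (subst phi (mkseq X n)).

Lemma bpos_rec X n : bpos X n.+1 = (bpos X n + m + (X n == 0%R))%N.
Proof. by rewrite /bpos mkseqS subst_rcons size_cat size_phi addnA. Qed.

Lemma bpos0 X : bpos X 0 = 0%N.
Proof. by []. Qed.

Lemma leq_bpos X n : (m * n <= bpos X n)%N.
Proof. by elim: n => [|n IH]; rewrite ?bpos0 ?bpos_rec; lia. Qed.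

Lemma image_at X Y n a : is_image phi X Y -> (a < m + (X n == 0%R))%N ->
  Y (bpos X n + a)%N = nth 0 (phi (X n)) a.
Proof.
move=> XY lt_a; have /XY wY := pre_mkseq X n.+1.
rewrite -(pre_nth 0 wY) mkseqS subst_rcons.
  by rewrite nth_cat ltnNge leq_addr addKn.
by rewrite size_cat size_phi ltn_add2l.
Qed.

Lemma image_zero X Y n a :
  is_image phi X Y -> (a < m)%N -> Y (bpos X n + a)%N = 0.
Proof.
move=> XY lt_a; rewrite (image_at XY) ?ltn_addr // nth_cat size_nseq lt_a.
by rewrite nth_nseq lt_a.
Qed.

Lemma image_one X Y n : is_image phi X Y -> X n = 0 -> Y (bpos X n + m)%N = 1.
Proof.
move=> XY Xn; rewrite (image_at XY); last by rewrite Xn eqxx addn1.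
by rewrite Xn /phi nth_cat size_nseq ltnn subnn.
Qed.

(** At offset $m$ stands the final 1 of the block $\phi(0)$ or, after a block $\phi(1)$, the first 0
    of the next block. *)
Lemma image_eq0 X Y n :
  is_image phi X Y -> (X n == 0) = (Y (bpos X n + m)%N != 0).
Proof.
move=> XY; have [/eqP/(image_one XY) -> //|Xn] := boolP (X n == 0).
have := @image_zero X Y n.+1 0 XY isT.
by rewrite bpos_rec (negbTE Xn) !addn0 => ->.
Qed.

Lemma image_oneP X Y k : is_image phi X Y -> Y k != 0 ->
  exists2 n, X n = 0 & k = (bpos X n + m)%N.
Proof.
move=> XY Yk.
(* The least such [n] indexes the block that contains position [k]. *)
have ex_n : exists n, (k < bpos X n.+1)%N.
  by exists k; have := leq_bpos X k.+1; rewrite /m; nia.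
case: (ex_minnP ex_n) => n lt_k min_n.
have le_k : (bpos X n <= k)%N.
  by case: n min_n {lt_k} => // n /(_ n)/contraNleq; apply; rewrite ltnn.
have {lt_k} := lt_k; rewrite bpos_rec => lt_k.
have [lt_m|ge_m] := ltnP (k - bpos X n) m.
  by move: Yk; rewrite -(subnKC le_k) (image_zero _ XY).
exists n; first by apply/eqP; case: (X n == 0) lt_k => //=; lia.
by case: (X n == 0) lt_k => /=; lia.
Qed.

Lemma image_shift X Y n :
  is_image phi X Y -> is_image phi (shift n X) (shift (bpos X n) Y).
Proof.
move=> XY w wX.
have /XY : is_prefix (mkseq X n ++ w) X.
  rewrite /is_prefix size_cat size_mkseq /mkseq iotaD map_cat add0n; congr (_ ++ _).
  by rewrite [LHS]wX -[X in iota X _]addn0 iotaDl -map_comp.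
rewrite subst_cat => pY; apply: (preP (x0 := 0)) => i lt_i.
rewrite /shift -(pre_nth 0 pY) ?size_cat ?ltn_add2l //.
by rewrite nth_cat ltnNge leq_addr addKn.
Qed.

(** The block starts agree by induction: [image_eq0] reads each letter, hence each block length, off
    the common image. *)
Lemma image_inj X X' Y : is_image phi X Y -> is_image phi X' Y -> X = X'.
Proof.
move=> XY XY'.
have bposE n : bpos X n = bpos X' n.
  elim: n => // n IH.
  by rewrite !bpos_rec (image_eq0 _ XY) (image_eq0 _ XY') IH.
apply/funext => n; have := image_eq0 n XY'.
rewrite -bposE -(image_eq0 n XY).
have [->|Xn X'n] := eqVneq (X n) 0; first by move/eqP.
by rewrite (neq0_ord2 Xn) (neq0_ord2 (negbT X'n)).
Qed.

(** * Suffix relations between [U] and [W] *)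

Lemma U_m : U m = 1.
Proof. by have := image_one image_U U0; rewrite bpos0. Qed.

(** [L] begins with $10$, so [W] begins with $\phi(1)\phi(0)=0^{2m}1$. *)
Lemma W_2m : W (m + m)%N = 1.
Proof.
have L1 : L 1 = 0 by rewrite -(pre_nth 0 pre_L0).
by have := image_one image_L_W L1; rewrite bpos_rec bpos0 L0 addn0.
Qed.

(** Infinite descent: [W] as a shift of [U] makes [L] a shift of [U], which in turn gives [W] at a
    smaller shift. *)
Lemma U_not_shift_W n : shift n U <> W.
Proof.
elim/ltn_ind: n => n IH UW.
have Un2m : U (n + (m + m))%N != 0 by rewrite -[U _]/(shift n U _) UW W_2m.
have [p Up /eqP] := image_oneP image_U Un2m.
rewrite addnA eqn_add2r => /eqP eq_p.
case: p Up eq_p => [|p] Up; first by rewrite bpos0 /m; lia.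
rewrite bpos_rec.
(* If [U p] were 0, its block would end with a 1 at position $n+m-1$ of [U], that is at position
   $m-1$ of [W], which holds 0. *)
have [/eqP Up'|Up'] := boolP (U p == 0).
  have := image_one image_U Up' => /[swap] eq_p.
  have -> : (bpos U p + m = n + m')%N by move: eq_p; rewrite /m; lia.
  rewrite -[U _]/(shift n U _) UW -[m' in W m'](@add0n m').
  by rewrite (image_zero 0 image_L_W).
rewrite addn0 => /eqP; rewrite eqn_add2r => /eqP eq_n.
have UL : shift p U = L.
  apply: (@image_inj _ _ W); last exact: image_L_W.
  by rewrite -UW eq_n; apply: image_shift; apply: image_U.
(* The 1 at position [p] ends a block $\phi(0)$; the $m$ zeros before it extend [L] to
   $0^mL=\phi(W)$. *)
have [q Uq eq_p] := image_oneP image_U Up'.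
have : shift q U = W.
  apply: (@image_inj _ _ (wcat (nseq m 0) L)); last exact: image_W_0L.
  suff -> : wcat (nseq m 0) L = shift (bpos U q) U.
    exact/image_shift/image_U.
  apply/funext => k; rewrite /wcat /shift nth_nseq size_nseq -UL.
  case: ltnP => [lt_k|le_k]; first by rewrite (image_zero _ image_U).
  by rewrite /shift eq_p -addnA subnKC.
apply: IH; have := leq_bpos U p; have := leq_bpos U q; rewrite eq_n eq_p /m; nia.
Qed.

(** The same descent, now through a shift of [L] equal to [U]. For $m=1$ it must break down, since
    then $W=0U$. *)
Lemma W_not_shift_U n : (1 < m)%N -> shift n W <> U.
Proof.
move=> m_gt1; elim/ltn_ind: n => n IH WU.
have Wnm : W (n + m)%N != 0 by rewrite -[W _]/(shift n W _) WU U_m.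
have [p Lp /eqP] := image_oneP image_L_W Wnm.
rewrite eqn_add2r => /eqP eq_n.
have LU : shift p L = U.
  apply: (@image_inj _ _ U); last exact: image_U.
  by rewrite -WU eq_n; apply/image_shift/image_L_W.
have p_gt0 : (0 < p)%N by case: p Lp {eq_n LU}; rewrite ?L0.
set M := wcat (nseq m 0) L.
have ME k : M (m + k)%N = L k.
  by rewrite /M /wcat size_nseq nth_default ?size_nseq ?leq_addr ?addKn.
have Mpm : M (m + p + m)%N != 0.
  by rewrite -addnA ME -[L _]/(shift p L m) LU U_m.
have [q Wq /eqP] := image_oneP image_W_0L Mpm.
rewrite eqn_add2r => /eqP eq_p.
have : shift q W = U.
  apply: (@image_inj _ _ U); last exact: image_U.
  suff <- : shift (bpos W q) M = U by apply/image_shift/image_W_0L.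
  by rewrite -eq_p -LU; apply/funext => k; rewrite /shift -addnA ME.
(* From $n\ge mp$ and $mq\le m+p$ with $p\ge1$, the hypothesis $m>1$ gives $q<n$. *)
apply: IH; have := leq_bpos L p; have := leq_bpos W q.
by rewrite -eq_n -eq_p; nia.
Qed.

(** * Equality of the languages *)

Lemma infix_subst_phir w x : infix (subst phir w) (subst phi (rcons w x)).
Proof.
(* The letter [x] contributes the $0^m$ needed by [subst_phi_conj]. *)
rewrite subst_rcons {2}/phi catA subst_phi_conj -catA.
by apply/infixP; exists (nseq m 0), (nseq (x == 0) 1).
Qed.

(** The reversal of $\phi(w)$ is $\tilde\phi$ of the reversal of $w$, a factor of $\phi$ of that
    reversal extended by one letter; so reversals of all $\phi^n(0)$ are factors of [U]. *)
Lemma language_U_rev w : language U w -> language U (rev w).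
Proof.
have rev_approx n : language U (rev (approx phi 0 n)).
  elim: n => [|n IH]; first exact: pre_language (pre_approx_phi 0).
  rewrite /approx iterS rev_subst_phi.
  have [x /(language_subst image_U)] := language_extend IH.
  exact/language_infix/infix_subst_phir.
move=> /languageP[p [pU wp]]; apply: language_infix (rev_approx (size p)).
rewrite infix_rev; apply: infix_trans wp _; apply: prefixW.
exact: prefix_fixpoint phi_gt0 size_phi0 phi0_head _ pU.
Qed.

(** The word counterpart of multiplication by $-\beta$: the window [rev l | r] becomes
    [rev (subst phir r) | subst phi l]. *)
Lemma bi_language_subst w :
  bi_language (bi W L) w -> bi_language (bi W L) (subst phi (rev w)).
Proof.
move=> /bi_languageP[l [r [lL rW w_lr]]]; apply/bi_languageP.
exists (subst phir r), (subst phi l); split.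
- exact: image_W_L.
- exact: image_L_W.
rewrite rev_subst_phir -subst_cat; apply: infix_subst.
by move: w_lr; rewrite -infix_rev rev_cat revK.
Qed.

Lemma bi_language_subst_rev w :
  bi_language (bi W L) w -> bi_language (bi W L) (rev (subst phi w)).
Proof.
move=> /bi_language_extend[x /bi_language_subst]; rewrite rev_cons rev_subst_phi.
exact/bi_language_infix/infix_subst_phir.
Qed.

(** The two preceding closure properties, applied in turn, cancel their reversals and apply $\phi$
    twice; hence even iterates. *)
Lemma bi_language_approx n : bi_language (bi W L) (approx phi 0 n.*2).
Proof.
elim: n => [|n IH].
  by apply/bi_languageP; exists [::], [:: 0].
rewrite doubleS /approx !iterS -[subst phi (iter _ _ _)]revK.
exact/bi_language_subst/bi_language_subst_rev.
Qed.

Lemma size_grow f X w :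
  nonerasing f -> is_prefix w X -> X 0 = 0 -> (1 < size (f 0%R))%N ->
  (0 < size w)%N -> (size w < size (subst f w))%N.
Proof.
move=> f0 wX X0 f0_gt1; case: w wX => [//|x w] wX _.
by have x0 : x = 0; [rewrite -X0 -(pre_nth 0 wX) | rewrite x0 ltn_size_subst].
Qed.

(* The factors around the delimiter are obtained from the factor 1|0 of U by
   iterating reversal followed by phi. *)
Lemma central_factors n :
  exists l r, [/\ is_prefix l L, is_prefix r W, (n < size l)%N, (n < size r)%N &
                  language U (rev l ++ r)].
Proof.
pose step (lr : seq 'I_2 * seq 'I_2) := (subst phir lr.2, subst phi lr.1).
have step_lang l r : language U (rev l ++ r) ->
    language U (rev (step (l, r)).1 ++ (step (l, r)).2).
  move=> /language_U_rev/(language_subst image_U) /=.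
  by rewrite rev_cat revK subst_cat rev_subst_phir.
elim: n => [|n [l [r [lL rW lt_l lt_r lr_lang]]]].
  exists [:: 1], [:: 0]; split=> //.
  have U2 : is_prefix (subst phi [:: 0] ++ nseq 1 0) U.
    exact: image_block image_U (pre_approx_phi 0) _.
  apply: language_infix (pre_language U2).
  apply/infixP; exists (nseq m 0), [::].
  by rewrite !subst_cons !cats0 -catA.
(* Two steps at a time: strict growth is guaranteed for words beginning with 0, and [L] begins with
   1. *)
exists (subst phir (subst phi l)), (subst phi (subst phir r)); split.
- exact/image_W_L/image_L_W.
- exact/image_L_W/image_W_L.
- have le_l := size_subst l phi_gt0.
  apply: (leq_ltn_trans lt_l (leq_ltn_trans le_l _)).
  apply: (size_grow phir_gt0 (image_L_W lL) W0) => //.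
  exact: leq_trans (leq_ltn_trans (leq0n n) lt_l) le_l.
- apply: (leq_ltn_trans lt_r (leq_trans _ (size_subst _ phi_gt0))).
  apply: (size_grow phir_gt0 rW W0) => //.
  exact: leq_ltn_trans (leq0n n) lt_r.
exact: step_lang (step_lang _ _ lr_lang).
Qed.

Lemma language_U_W : language U = bi_language (bi W L).
Proof.
apply/seteqP; split=> w.
  move=> /languageP[p [pU wp]].
  apply: bi_language_infix (bi_language_approx (size p)).
  apply: infix_trans wp _; apply: prefixW; apply: (prefix_pre pU).
    exact: pre_approx_phi.
  apply: leq_trans (ltnW (size_approx phi_gt0 size_phi0 phi0_head _)).
  by rewrite -addnn leq_addr.
move=> /bi_languageP[l [r [lL rW w_lr]]].
have [l' [r' [l'L r'W lt_l lt_r lang_lr]]] := central_factors (size l + size r).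
have /prefixP[a eq_l] : prefix l l'.
  apply: prefix_pre lL l'L _.
  exact: leq_trans (leq_addr _ _) (ltnW lt_l).
have /prefixP[b eq_r] : prefix r r'.
  apply: prefix_pre rW r'W _.
  exact: leq_trans (leq_addl _ _) (ltnW lt_r).
apply: language_infix lang_lr; apply: infix_trans w_lr _.
by rewrite eq_l eq_r rev_cat; apply/infixP; exists (rev a), b; rewrite -!catA.
Qed.

End Substitution.

(** * The case $m=1$ *)

Lemma approx_sigma_1 n :
  approx (sigma 0) 0 n ++ [:: 0] = 0 :: approx (phi 0) 0 n.*2.
Proof.
(* For $m=1$ the substitutions $\phi^2$ and $\sigma$ are conjugate by the word $01$. *)
have phi2 w : subst (phi 0) (subst (phi 0) w) ++ [:: 0; 1] =
    [:: 0; 1] ++ subst (sigma 0) w.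
  elim: w => [//|x w IH]; rewrite !(subst_cons _ x) subst_cat -catA IH.
  by case: (eqVneq x 0) => [-> //|/neq0_ord2 -> //].
elim: n => [//|n IH].
set w := approx (sigma 0) 0 n in IH *; set v := approx (phi 0) 0 n.*2 in IH *.
have -> : approx (sigma 0) 0 n.+1 = subst (sigma 0) w by [].
have -> : approx (phi 0) 0 n.+1.*2 = subst (phi 0) (subst (phi 0) v) by [].
(* With $w0=0v$ this reads $010\,\phi^2(v)\,01=01\,\sigma(w)\,001$; then $01$ is cancelled at both
   ends. *)
have := phi2 (w ++ [:: 0]).
rewrite {1}IH subst_cat (subst_cons _ _ v) subst_cat.
case; rewrite -[subst (sigma 0) [:: 0]]/([:: 0] ++ [:: 0; 1]) catA.
rewrite -cat_cons => /(congr1 rev); rewrite !(rev_cat _ [:: 0; 1]) => /eqP.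
by rewrite eqseq_cat // => /andP[_ /eqP/(can_inj revK)] <-.
Qed.

Lemma W_1 : W 0 = wcat [:: 0] (U 0).
Proof.
apply/funext => k; have lt_k :=
  size_approx (sigma_gt0 0) (size_sigma0 0) (sigma0_head 0) k.
rewrite -(pre_nth 0 (pre_approx_sigma 0 k)) //.
have := f_equal (fun s => nth 0 s k) (approx_sigma_1 k).
rewrite nth_cat lt_k => ->; case: k lt_k => [//|k] lt_k.
rewrite /wcat subn1 [RHS]nth_default //=.
apply: (pre_nth 0 (pre_approx_phi 0 k.+1.*2)).
apply: leq_ltn_trans (size_approx (phi_gt0 0) (size_phi0 0) (phi0_head 0) _).
by rewrite -addnn; lia.
Qed.

(** * Enumerations of sets of reals *)

Section Enumerations.
Variable R : realType.
Implicit Types (S : set R) (t : int -> R).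

Lemma int_step_homo t : (forall j, t j < t (j + 1)) -> {homo t : i j / i < j}.
Proof.
move=> t_incr i j lt_ij; have {lt_ij} [n ->] : exists n : nat, j = i + n.+1%:Z.
  by exists (`|j - i|.-1)%N; lia.
elim: n => [|n IH]; first exact: t_incr.
apply: lt_trans IH _; have -> : i + n.+2%:Z = i + n.+1%:Z + 1 by lia.
exact: t_incr.
Qed.

(** Lets the chosen [enumeration] be replaced by an explicit one. Enumerations that agree at $j$
    agree at both neighbours, and both vanish at 0. *)
Lemma enumerates_uniq S t t' : enumerates S t -> enumerates S t' -> t = t'.
Proof.
have next s s' j : enumerates S s -> enumerates S s' -> s j = s' j ->
    s' (j + 1) <= s (j + 1).
  move=> [_ s_incr sS] [_ s'_incr s'S] eq_j.
  have [k _ eq_k] : range s' (s (j + 1)) by rewrite s'S -sS; exists (j + 1).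
  rewrite -eq_k; have [->//|lt_jk] := eqVneq (j + 1) k.
  apply/ltW/(int_step_homo s'_incr).
  have lt_s' : s' j < s' k by rewrite eq_k -eq_j.
  have [le_kj|] := leP k j; last lia.
  have [eq_kj|lt_kj] := eqVneq k j; first by rewrite eq_kj ltxx in lt_s'.
  have /(int_step_homo s'_incr) : (k < j)%R by lia.
  by rewrite ltNge (ltW lt_s').
have prev s s' j : enumerates S s -> enumerates S s' -> s (j + 1) = s' (j + 1) ->
    s' j <= s j.
  move=> [_ s_incr sS] [_ s'_incr s'S] eq_j.
  have [k _ eq_k] : range s (s' j) by rewrite sS -s'S; exists j.
  rewrite -eq_k; have [->//|lt_jk] := eqVneq k j.
  apply/ltW/(int_step_homo s_incr).
  have lt_s : s k < s (j + 1) by rewrite eq_k eq_j.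
  have [le_kj|] := leP (j + 1) k; last lia.
  have [eq_kj|lt_kj] := eqVneq k (j + 1); first by rewrite eq_kj ltxx in lt_s.
  have /(int_step_homo s_incr) : (j + 1 < k)%R by lia.
  by rewrite ltNge (ltW lt_s).
move=> St St'; have eq0 : t 0 = t' 0 by case: St St' => -> _ _ [-> _ _].
apply/funext => j; elim/int_rec: j => [//|n IH|n IH].
  by rewrite -addn1 PoszD; apply: le_anti; rewrite !next.
have eqn : - n%:Z = - n.+1%:Z + 1 by lia.
by rewrite eqn in IH; apply: le_anti; rewrite !prev.
Qed.

Lemma enumerationE S t : enumerates S t -> enumeration S = t.
Proof.
move=> St; apply: (@enumerates_uniq S) => //.
exact: (xgetPex (fun=> 0) (ex_intro _ t St)).
Qed.

End Enumerations.

(** * Beta-integers and (-beta)-integers *)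

Section BetaNumeration.
Variables (R : realType) (m' : nat) (beta : R).
Local Notation m := (m'.+1).
Hypothesis beta_gt1 : 1 < beta.
Hypothesis beta_root : beta ^+ 2 - m%:R * beta - m%:R = 0.
Implicit Types (x : 'I_2) (w : seq 'I_2) (X Y u : nat -> 'I_2).
Local Notation Delta := (Delta m beta).

(** * Arithmetic of $\beta$ and of the gap lengths *)

Lemma beta_gt0 : 0 < beta.
Proof. exact: lt_trans ltr01 beta_gt1. Qed.

Lemma m_ge1 : 1 <= m%:R :> R.
Proof. by rewrite ler1n. Qed.

Lemma m_div_beta : m%:R / beta = beta - m%:R.
Proof.
have b0 : beta != 0 by rewrite gt_eqF ?beta_gt0.
apply: (mulIf b0); rewrite divfK // mulrBl -expr2; have := beta_root; lra.
Qed.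

(** Since $\beta^2=m(\beta+1)$, one has $\beta/(\beta+1)=m/\beta=\beta-m$. *)
Lemma lnegE : lneg beta = m%:R - beta.
Proof.
have b0 : beta != 0 by rewrite gt_eqF ?beta_gt0.
have b10 : beta + 1 != 0 by rewrite gt_eqF // ltr_wpDr ?beta_gt0.
rewrite -opprB -m_div_beta /lneg; congr (- _); apply/eqP.
rewrite eqr_div //; apply/eqP.
rewrite -expr2; have := beta_root; lra.
Qed.

Lemma beta_gtm : m%:R < beta.
Proof.
by rewrite -subr_gt0 -m_div_beta divr_gt0 ?ltr0n ?beta_gt0.
Qed.

Lemma beta_ltm1 : beta < m%:R + 1.
Proof.
by rewrite -ltrBlDl -m_div_beta ltr_pdivrMr ?mul1r ?beta_gtm ?beta_gt0.
Qed.

Lemma Delta0 : Delta 0 = 1.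
Proof. by []. Qed.

Lemma Delta1 : Delta 1 = beta - m%:R.
Proof. by rewrite -m_div_beta. Qed.

Lemma DeltaP x : Delta x = 1 \/ Delta x = beta - m%:R.
Proof. by have [->|/neq0_ord2->] := eqVneq x 0; [left | right; rewrite Delta1]. Qed.

Lemma Delta_gt0 x : 0 < Delta x.
Proof. by have := beta_gtm; case: (DeltaP x) => ->; lra. Qed.

Lemma Delta_inj : injective Delta.
Proof.
move=> x y; have := beta_ltm1.
have [->|/neq0_ord2->] := eqVneq x 0; have [->|/neq0_ord2->] := eqVneq y 0 => //;
  by rewrite Delta0 Delta1 => *; exfalso; lra.
Qed.

Lemma floor_nat (z : R) : 0 <= z ->
  exists a : nat, [/\ Num.floor z = a%:Z, a%:R <= z & z < a%:R + 1].
Proof.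
move=> z0; have := floor_ge0 z; rewrite z0; have := floor_itv z.
case: (Num.floor z) => // a /andP[le_a lt_a] _; exists a; split=> //.
by move: lt_a; rewrite intrD.
Qed.

(** * Words as sequences of tiles of lengths [Delta] *)

Definition len w : R := \sum_(x <- w) Delta x.
Definition pos u n : R := len (mkseq u n).

Lemma len_cat v w : len (v ++ w) = len v + len w.
Proof. by rewrite /len big_cat. Qed.

Lemma len_nseq0 a : len (nseq a 0) = a%:R.
Proof.
by elim: a => [|a IH]; rewrite /len ?big_nil // big_cons -/(len _) IH -natr1 addrC.
Qed.

(** The lengths form an eigenvector of $\phi$: $m+(\beta-m)=\beta$ and $m=\beta(\beta-m)$. *)
Lemma len_phi x : len (phi m' x) = beta * Delta x.
Proof.
rewrite len_cat len_nseq0; have [->|/neq0_ord2->] := eqVneq x 0.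
  rewrite /len big_seq1 Delta0 Delta1; ring.
rewrite /len big_nil Delta1 mulrBr -expr2. have := beta_root; lra.
Qed.

Lemma len_rev w : len (rev w) = len w.
Proof. exact/perm_big/permEl/perm_rev. Qed.

Lemma len_subst_phi w : len (subst (phi m') w) = beta * len w.
Proof.
elim: w => [|x w IH]; first by rewrite /len !big_nil mulr0.
by rewrite subst_cons len_cat IH len_phi /len big_cons mulrDr.
Qed.

Lemma len_subst_phir w : len (subst (phir m') w) = beta * len w.
Proof. by rewrite -{1}(revK w) -rev_subst_phi len_rev len_subst_phi len_rev. Qed.

Lemma len_pre w u : is_prefix w u -> len w = pos u (size w).
Proof. by move=> {1}->. Qed.

Lemma pos0 u : pos u 0 = 0.
Proof. by rewrite /pos /len big_nil. Qed.

Lemma posS u n : pos u n.+1 = pos u n + Delta (u n).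
Proof. by rewrite /pos mkseqS -cats1 len_cat /len big_seq1. Qed.

Definition bipos X Y (j : int) : R :=
  match j with Posz n => pos X n | Negz n => - pos Y n.+1 end.

Lemma bipos_gap X Y j : bipos X Y (j + 1) = bipos X Y j + Delta (bi X Y j).
Proof.
case: j => [n|[|n]].
- by rewrite -PoszD addn1 /= posS.
- by have -> : Negz 0 + 1 = 0 by []; rewrite /= posS !pos0 add0r addNr.
have -> : Negz n.+1 + 1 = Negz n by lia.
by rewrite /= [pos Y n.+2]posS; lra.
Qed.

Lemma bipos_lt X Y j : bipos X Y j < bipos X Y (j + 1).
Proof. by rewrite bipos_gap ltrDl Delta_gt0. Qed.

Lemma biposN X Y n : bipos X Y (- n%:Z) = - pos Y n.
Proof. by case: n => [|n]; rewrite ?oppr0 /= ?pos0 ?oppr0. Qed.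

Lemma codingE S X Y : enumerates S (bipos X Y) -> coding m beta S = bi X Y.
Proof.
move=> St; apply/funext => j; rewrite /coding (enumerationE St) bipos_gap addrC addKr.
case: pickP => [x /eqP/Delta_inj //|/(_ (bi X Y j))]; by rewrite eqxx.
Qed.

Lemma expr_unbounded (y : R) : exists k, y < beta ^+ k.
Proof.
(* The exponent is doubled because $\beta$ may be below 2, whereas $\beta^2=m\beta+m>2$. *)
exists (2 * Num.bound y)%N.
apply: lt_le_trans (upper_nthrootP (leqnn _)) _.
rewrite exprM lerXn2r ?nnegrE ?exprn_ge0 ?(ltW beta_gt0) //.
have := m_ge1; have := beta_gt1; have := beta_root; nra.
Qed.

(** For the remainder after $k$ steps: if all later digits vanish, each step only multiplies it by
    $\pm\beta$, yet it stays bounded. *)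
Lemma bounded_expr_eq0 (z : R) : (forall n, `|z| * beta ^+ n <= 1) -> z = 0.
Proof.
move=> bnd; apply/eqP/negPn/negP => z0.
have zgt0 : 0 < `|z| by rewrite normr_gt0.
have [k lt_k] := expr_unbounded (`|z|^-1).
have := bnd k; rewrite leNgt => /negP; apply.
by rewrite -(ltr_pM2l zgt0) mulfV ?normr_eq0 in lt_k.
Qed.


(** * Expansions in base $\beta$ *)

Section PositiveBase.
Variable t : nat -> R.
Hypothesis t0 : t 0%N = 0.
Hypothesis t1 : t 1%N = 1.
Hypothesis t_gap : forall n, t n.+1 = t n + 1 \/ t n.+1 = t n + (beta - m%:R).
Hypothesis t_block : forall n, exists n', forall a, (a <= m)%N ->
  t (n' + a)%N = beta * t n + a%:R.

Lemma nat_points_homo : {homo t : i j / (i < j)%N >-> i < j}.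
Proof.
apply: homo_ltn => [|n]; first exact: lt_trans.
by have := beta_gtm; case: (t_gap n) => ->; lra.
Qed.

(** The tile of $x/\beta$ that starts at [t n] inflates to an interval around $x$ subdivided by
    [t_block]; the next digit [a] selects the subtile of $x$. *)
Lemma iter_Tpos k (x : R) : 0 <= x / beta ^+ k < 1 ->
  exists n, [/\ iter k (Tpos beta) (x / beta ^+ k) = x - t n,
                t n <= x & x < t n.+1].
Proof.
have b0 := beta_gt0.
elim: k x => [|k IH] x.
  by rewrite expr0 divr1 => /andP[x0 x1]; exists 0%N; rewrite t0 t1 subr0.
rewrite exprS invfM mulrA => /IH[n [Dn tn_le lt_tn]].
rewrite iterS Dn /Tpos; set z := beta * _.
have zE : z = x - beta * t n by rewrite /z mulrBr mulrC divfK ?gt_eqF.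
have z0 : 0 <= z by rewrite mulr_ge0 ?subr_ge0 // ltW.
have lt_x : x < beta * t n.+1 by rewrite mulrC -ltr_pdivrMr.
have lt_z : z < beta.
  by rewrite zE; case: (t_gap n) lt_x => ->; have := beta_ltm1; nra.
have [a [-> a_le lt_a]] := floor_nat z0.
have le_am : (a <= m)%N.
  by rewrite -ltnS -(ltr_nat R) -[m.+1%:R]natr1; have := beta_ltm1; lra.
have [n' block] := t_block n; have block_a := block _ le_am.
exists (n' + a)%N; rewrite block_a; split; [by rewrite zE /=; lra | by lra |].
(* A unit tile is settled by $z<a+1$. If $a<m$, the next point is still in the block. If $a=m$ and
   the tile is short, tile [n] has length 1, as a short one inflates to length $m\le z$; the next
   point is then its inflated end. *)
have [->|gap] := t_gap (n' + a); first by rewrite block_a; lra.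
have [lt_am|ge_am] := ltnP a m.
  by rewrite -addnS block //; rewrite -natr1; lra.
have {ge_am} eq_am : a = m by apply/eqP; rewrite eqn_leq le_am.
rewrite gap block_a eq_am; have [tn|tn] := t_gap n.
  by move: lt_x; rewrite tn; lra.
by move: a_le lt_x; rewrite eq_am tn zE; have := beta_root; nra.
Qed.

Lemma pos_digits_eq0 (y : R) k : 0 <= iter k (Tpos beta) y < 1 ->
  (forall i, (k < i)%N -> pos_digit beta y i = 0) <-> iter k (Tpos beta) y = 0.
Proof.
set z := iter _ _ _ => /andP[z0 z1].
have digitE n : pos_digit beta y (n + k).+1 =
    Num.floor (beta * iter n (Tpos beta) z).
  by rewrite /pos_digit /= iterD.
split=> [digits0|eq_z0 i lt_ki].
  have iterE n : iter n (Tpos beta) z = z * beta ^+ n /\ z * beta ^+ n < 1.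
    elim: n => [|n [IH _]]; first by rewrite expr0 mulr1.
    have := digits0 (n + k).+1; rewrite digitE ltnS leq_addl IH => /(_ isT) fl0.
    rewrite iterS IH /Tpos fl0 subr0 exprSr [z * (_ * _)]mulrA [_ * beta]mulrC.
    have := floor_itv (beta * (z * beta ^+ n)).
    by rewrite fl0 add0r => /andP[_].
  apply: bounded_expr_eq0 => n; rewrite ger0_norm //.
  by have [_ /ltW] := iterE n.
have -> : i = (i - k.+1 + k).+1 by lia.
rewrite digitE eq_z0; elim: (i - k.+1)%N => [|n IH]; first by rewrite /= mulr0 floor0.
have iter0 : iter n (Tpos beta) 0 = 0.
  by elim: n {IH} => //= n ->; rewrite /Tpos mulr0 floor0 subr0.
by rewrite /= iter0 /Tpos mulr0 floor0 subr0 mulr0 floor0.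
Qed.

Lemma Zbeta_plusE : Zbeta_plus beta = range t.
Proof.
have t_ge0 n : 0 <= t n.
  case: n => [|n]; first by rewrite t0.
  by rewrite -t0; apply/ltW/nat_points_homo.
apply/seteqP; split=> x.
  move=> [x0 [k [kx digits0]]]; have [n [Dn tn_le lt_tn]] := iter_Tpos kx.
  have D01 : 0 <= iter k (Tpos beta) (x / beta ^+ k) < 1.
    rewrite Dn subr_ge0 tn_le ltrBlDl.
    by have := beta_ltm1; case: (t_gap n) lt_tn => ->; lra.
  exists n => //; apply/esym/eqP; rewrite -subr_eq0 -Dn.
  exact/eqP/(pos_digits_eq0 D01).
move=> [n _ <-]; split=> //; have [k lt_k] := expr_unbounded (t n).
have bk0 : 0 < beta ^+ k by rewrite exprn_gt0 ?beta_gt0.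
have kx : 0 <= t n / beta ^+ k < 1.
  by rewrite divr_ge0 ?ltr_pdivrMr ?mul1r ?(ltW bk0).
exists k; split=> //; have [n' [Dn tn_le lt_tn]] := iter_Tpos kx.
have eq_n : n = n'.
  apply/eqP; rewrite eqn_leq; apply/andP; split; rewrite leqNgt; apply/negP.
    rewrite -ltnS ltnS leq_eqVlt => /predU1P[eq_n|/nat_points_homo].
      by rewrite -eq_n ltxx in lt_tn.
    by rewrite ltNge ltW.
  by move=> /nat_points_homo; rewrite ltNge tn_le.
apply/pos_digits_eq0; rewrite Dn eq_n subrr //.
by rewrite lexx ltr01.
Qed.

End PositiveBase.

(** * Expansions in base $-\beta$ *)

Section NegativeBase.
Variable t : int -> R.
Hypothesis t0 : t 0 = 0.
Hypothesis t_gap : forall j,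
  t (j + 1) = t j + 1 \/ t (j + 1) = t j + (beta - m%:R).
Hypothesis t_block : forall j, exists J, forall a : nat, (a <= m)%N ->
  t (J + a%:Z) = - beta * t j + a%:R.

Lemma int_points_pred j :
  t (j - 1) = t j - 1 \/ t (j - 1) = t j - (beta - m%:R).
Proof. by case: (t_gap (j - 1)); rewrite subrK => ->; [left | right]; ring. Qed.

Lemma int_points_homo : {homo t : i j / i < j}.
Proof.
apply: int_step_homo => j.
by have := beta_gtm; case: (t_gap j) => ->; lra.
Qed.

(** With $l$ for [lneg beta], this says $l+1<\beta-m=-l$: every gap exceeds $l+1$, and $|y|<l+1$
    implies $y>l$. *)
Lemma half_lt_gap : 1 < 2 * (beta - m%:R).
Proof. by have := beta_gt1; have := beta_root; have := beta_gtm; nra. Qed.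

(* For a gap beta - m = - lneg beta the point t (j - 1) is the left end of the
   interval t j + [lneg, lneg + 1), hence its exclusion. *)
Lemma iter_Tneg k (x : R) :
  lneg beta < x / (- beta) ^+ k < lneg beta + 1 ->
  exists j, [/\ iter k (Tneg beta) (x / (- beta) ^+ k) = x - t j,
                lneg beta <= x - t j < lneg beta + 1 & x <> t (j - 1)].
Proof.
have b0 := beta_gt0; have ltm := beta_gtm; have ltm1 := beta_ltm1.
have root := beta_root.
elim: k x => [|k IH] x.
  rewrite expr0 divr1 => /andP[x0 x1]; exists 0; rewrite t0 subr0; split=> //.
    by rewrite ltW.
  by rewrite lnegE in x0; case: (int_points_pred 0) => ->; rewrite t0; lra.
rewrite exprS invfM mulrA => /IH[j [Dj /andP[y_ge y_lt] _]].
rewrite iterS Dj /Tneg; set z := - beta * _.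
have zE : z = x + beta * t j.
  by rewrite /z mulrBr mulrC divfK ?oppr_eq0 ?gt_eqF // mulNr opprK.
rewrite lnegE in y_ge y_lt *; set y := x / _ - t j in y_ge y_lt z zE *.
(* As $-\beta(l+1)=l$ and $-\beta l=m$ for $l$ = [lneg beta], the interval
   $[l,l+1)$ is sent to $(l,m]$; strictness at $l$ is used below. *)
have z_gt : 0 < z - (m%:R - beta) by rewrite /z; nra.
have z_le : z <= m%:R by rewrite /z; nra.
have [a [-> a_le lt_a]] := floor_nat (ltW z_gt).
have le_am : (a <= m)%N.
  by rewrite -ltnS -(ltr_nat R) -[m.+1%:R]natr1; lra.
have [J block] := t_block j; have block_a := block _ le_am.
exists (J + a%:Z); rewrite block_a; split; first by rewrite zE /=; lra.
  by apply/andP; split; lra.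
(* For $a=0$ the previous point is at least $\beta-m=-l$ before [t J], so $z>l$ excludes it;
   otherwise that point is in the block. *)
case: a => [|a] in a_le lt_a le_am block_a *.
  by case: (int_points_pred (J + 0%:Z)) => ->; rewrite block_a; lra.
have -> : J + a.+1%:Z - 1 = J + a%:Z by lia.
by rewrite block ?(ltnW le_am) //; rewrite -natr1 in a_le; lra.
Qed.

Lemma neg_digits_eq0 (y : R) k :
  lneg beta <= iter k (Tneg beta) y < lneg beta + 1 ->
  (forall i, (k < i)%N -> neg_digit beta y i = 0) <-> iter k (Tneg beta) y = 0.
Proof.
have b0 := beta_gt0; have ltm := beta_gtm; have ltm1 := beta_ltm1.
set z := iter _ _ _ => /andP[z_ge z_lt].
have digitE n : neg_digit beta y (n + k).+1 =
    Num.floor (- beta * iter n (Tneg beta) z - lneg beta).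
  by rewrite /neg_digit /= iterD.
split=> [digits0|eq_z0 i lt_ki].
  have iterE n : iter n (Tneg beta) z = z * (- beta) ^+ n /\
      `|z * (- beta) ^+ n| <= 1.
    elim: n => [|n [IH _]].
      rewrite expr0 mulr1; split=> //.
      by rewrite lnegE in z_ge z_lt; rewrite ler_norml; apply/andP; split; lra.
    have := digits0 (n + k).+1; rewrite digitE ltnS leq_addl IH => /(_ isT) fl0.
    rewrite iterS IH /Tneg fl0 subr0 exprSr [z * (_ * _)]mulrA [_ * - beta]mulrC.
    split=> //; have := floor_itv (- beta * (z * (- beta) ^+ n) - lneg beta).
    rewrite fl0 add0r lnegE => /andP[]; rewrite mulr0z mulr1z => ? ?.
    by rewrite ler_norml; apply/andP; split; lra.
  apply: bounded_expr_eq0 => n; have [_] := iterE n.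
  by rewrite normrM normrX normrN (gtr0_norm b0).
have floor_l : Num.floor (- lneg beta) = 0.
  by apply: floor_def; rewrite mulr0z add0r mulr1z lnegE; apply/andP; split; lra.
have iter0 n : iter n (Tneg beta) 0 = 0.
  by elim: n => //= n ->; rewrite /Tneg mulr0 !sub0r floor_l oppr0.
have -> : i = (i - k.+1 + k).+1 by lia.
by rewrite digitE eq_z0 iter0 mulr0 sub0r.
Qed.

Lemma ZmbetaE : Zmbeta beta = range t.
Proof.
have b0 := beta_gt0; have ltm1 := beta_ltm1; have half := half_lt_gap.
apply/seteqP; split=> x.
  move=> [k [kx digits0]]; have [j [Dj D01 _]] := iter_Tneg kx.
  exists j => //; apply/esym/eqP; rewrite -subr_eq0 -Dj.
  by rewrite -Dj in D01; exact/eqP/(neg_digits_eq0 D01).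
move=> [i _ <-]; have [k lt_k] := expr_unbounded (`|t i| / (m%:R - beta + 1)).
have l1_gt0 : 0 < m%:R - beta + 1 by lra.
have bk0 : 0 < beta ^+ k by rewrite exprn_gt0.
have kx : lneg beta < t i / (- beta) ^+ k < lneg beta + 1.
  have : `|t i / (- beta) ^+ k| < m%:R - beta + 1.
    rewrite normrM normfV normrX normrN (gtr0_norm b0).
    by rewrite ltr_pdivrMr // mulrC -ltr_pdivrMr.
  by rewrite lnegE ltr_norml => /andP[? ?]; apply/andP; split; lra.
exists k; split=> //; have [j [Dj D01 neq_j]] := iter_Tneg kx.
(* On the left only [t (j - 1)] can be within $\beta-m$ of [t j], and it is excluded; on the right
   every gap exceeds $l+1$. *)
have eq_ij : i = j.
  rewrite lnegE in D01; case/andP: D01 => D0 D1.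
  have [lt_ij|lt_ji|//] := ltgtP i j.
    exfalso; have [eq_i|ne_i] := eqVneq i (j - 1); first by rewrite eq_i in neq_j.
    have /int_points_homo : i < j - 1 by lia.
    by case: (int_points_pred j) => ->; lra.
  exfalso; suff : t (j + 1) <= t i by case: (t_gap j) => ->; lra.
  have [->//|ne_i] := eqVneq i (j + 1).
  by apply/ltW/int_points_homo; lia.
apply/(neg_digits_eq0 _); rewrite Dj eq_ij subrr //.
by rewrite lnegE; apply/andP; split; lra.
Qed.

End NegativeBase.

(** * Explicit enumerations of both sets *)

Lemma pos_block X Y n : is_image (phi m') X Y ->
  exists n', forall a, (a <= m)%N -> pos Y (n' + a) = beta * pos X n + a%:R.
Proof.
move=> XY; exists (bpos m' X n) => a le_a.
have := len_pre (image_block XY (pre_mkseq X n) le_a).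
by rewrite size_cat size_nseq len_cat len_nseq0 len_subst_phi.
Qed.

(** Blocks of $\tilde\phi$ end in $0^m$, so points are counted back from the end [N] of block [n];
    reflected to the left half-line, they increase. *)
Lemma pos_block_rev X Y n : is_image (phir m') X Y ->
  exists N, forall a, (a <= m)%N ->
    (a <= N)%N /\ pos Y (N - a) = beta * pos X n.+1 - a%:R.
Proof.
move=> XY; exists (size (subst (phir m') (mkseq X n.+1))) => a le_a.
have wY := XY _ (pre_mkseq X n.+1).
have [s eq_s] : exists s, subst (phir m') (mkseq X n.+1) = s ++ nseq a 0.
  exists (subst (phir m') (mkseq X n) ++ nseq (X n == 0%R) 1 ++ nseq (m - a) 0).
  by rewrite mkseqS subst_rcons -!catA -nseqD subnK.
rewrite -len_subst_phir; rewrite eq_s size_cat size_nseq addnK leq_addl in wY *.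
by split=> //; rewrite len_cat len_nseq0 addrK -(len_pre (pre_catl wY)).
Qed.

Lemma enumerates_Zbeta :
  enumerates (Zbeta beta) (bipos (U m') (U m')).
Proof.
split; [exact: pos0 | exact: bipos_lt |].
have ZE : Zbeta_plus beta = range (pos (U m')).
  apply: Zbeta_plusE.
  - exact: pos0.
  - by rewrite posS pos0 add0r U0.
  - by move=> n; rewrite posS; case: (DeltaP (U m' n)) => ->; [left | right].
  - by move=> n; apply: pos_block; exact: image_U.
apply/seteqP; split=> x.
  move=> [[n|n] _ <-]; rewrite /Zbeta ZE; [left | right]; first by exists n.
  by exists (pos (U m') n.+1) => //; exists n.+1.
rewrite /Zbeta ZE => -[[n _ <-]|[_ [n _ <-] <-]]; first by exists n%:Z.
by exists (- n%:Z) => //; rewrite biposN.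
Qed.

Lemma enumerates_Zmbeta :
  enumerates (Zmbeta beta) (bipos (W m') (L m')).
Proof.
split; [exact: pos0 | exact: bipos_lt |].
apply/esym/ZmbetaE.
- exact: pos0.
- move=> j; rewrite bipos_gap.
  by case: (DeltaP (bi (W m') (L m') j)) => ->; [left | right].
(* The point 0 starts the first block of [W]; positive points are sent to the left half by
   $L=\tilde\phi(W)$, negative ones to the right half by $W=\phi(L)$. *)
move=> [[|n]|n].
- exists 0 => a le_a; rewrite add0r /= pos0 mulr0 add0r.
  have := len_pre (image_block (@image_L_W m') (pre_mkseq (L m') 0) le_a).
  by rewrite /= size_nseq len_nseq0.
- have [N block] := pos_block_rev n (@image_W_L m').
  exists (- N%:Z) => a le_a; have [le_aN posE] := block a le_a.
  have -> : - N%:Z + a%:Z = - (N - a)%N%:Z by lia.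
  by rewrite biposN posE /=; ring.
have [n' block] := pos_block n.+1 (@image_L_W m').
by exists n'%:Z => a le_a; rewrite -PoszD /= block // mulrNN.
Qed.

End BetaNumeration.

Theorem theorem4p3 (R : realType) (m : nat) (beta : R)
  (m_ge1 : (1 <= m)%N) (beta_gt1 : 1 < beta)
  (beta_root : beta ^+ 2 - m%:R * beta - m%:R = 0) :
  [/\ language (u_beta m beta) = bi_language (u_mbeta m beta),
      m = 1%N ->
        right_part (u_mbeta m beta) = wcat [:: 0] (u_beta m beta)
    & (2 <= m)%N ->
        ~ suffix_of (right_part (u_mbeta m beta)) (u_beta m beta) /\
        ~ suffix_of (u_beta m beta) (right_part (u_mbeta m beta))].
Proof.
case: m m_ge1 beta_root => // m' _ root.
have uE : u_beta m'.+1 beta = U m'.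
  by rewrite /u_beta (codingE beta_gt1 root (enumerates_Zbeta beta_gt1 root)).
have umE : u_mbeta m'.+1 beta = bi (W m') (L m').
  exact: codingE beta_gt1 root _ _ _ (enumerates_Zmbeta beta_gt1 root).
have rightE : right_part (bi (W m') (L m')) = W m' by [].
rewrite uE umE rightE; split=> [|[->]|m_ge2].
- exact: language_U_W.
- exact: W_1.
split=> /suffix_of_shift[n]; first exact: U_not_shift_W.
exact: W_not_shift_U.
Qed.
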